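(* Let $R$ be a non-zero commutative ring, let $q$ be an indeterminate, and let $S$ be the antipode of $\mathtt{QSym}^{(q)}$, as an $R[q]$-linear endomorphism. Then $S^{2}$ has infinite order on $\mathtt{QSym}^{(q)}$, i.e., $(S^{2})^{k}\neq\operatorname{Id}$ for every $k\geq1$.
   Context: A composition $\alpha\vDash n$ of an integer $n\geq0$ is a finite sequence $(\alpha_{1},\ldots,\alpha_{\ell})$ of positive integers summing to $n$; $\ell(\alpha)=\ell$ is its length, and $\emptyset$ is the only composition of $0$. The algebra $\mathtt{QSym}^{(q)}$. Consider power series over $R[q]$ in variables $x_{1},x_{2},\ldots$ subject to $x_{j}x_{i}=qx_{i}x_{j}$ for $i<j$. For a composition $\alpha$ of length $\ell$ set $M_{\alpha}^{(q)}=\sum_{i_{1}<\cdots<i_{\ell}}x_{i_{1}}^{\alpha_{1}}\cdots x_{i_{\ell}}^{\alpha_{\ell}}$. Then $\mathtt{QSym}^{(q)}$ is the free $R[q]$-module with basis $\{M_{\alpha}^{(q)}\}_{\alpha}$, $\alpha$ running over all compositions. It is closed under the product: $M_{\emptyset}^{(q)}=1$, and for $\alpha=(\alpha_{1},\bar{\alpha})$ with $\bar{\alpha}\vDash m$ and $\beta=(\beta_{1},\bar{\beta})$, $$M_{\alpha}^{(q)}M_{\beta}^{(q)}=l_{\alpha_{1}}(M_{\bar{\alpha}}^{(q)}M_{\beta}^{(q)})+q^{\beta_{1}(\alpha_{1}+m)}l_{\beta_{1}}(M_{\alpha}^{(q)}M_{\bar{\beta}}^{(q)})+q^{\beta_{1}m}l_{\alpha_{1}+\beta_{1}}(M_{\bar{\alpha}}^{(q)}M_{\bar{\beta}}^{(q)}),$$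 where $l_{a}$ is the $R[q]$-linear map with $l_{a}M_{\gamma}^{(q)}=M_{(a,\gamma)}^{(q)}$. The co-multiplication is $\Delta(M_{\alpha}^{(q)})=\sum_{k=0}^{\ell(\alpha)}M_{(\alpha_{1},\ldots,\alpha_{k})}^{(q)}\otimes M_{(\alpha_{k+1},\ldots,\alpha_{\ell(\alpha)})}^{(q)}$ (tensor over $R[q]$), and the co-unit $\varepsilon$ sends $M_{\emptyset}^{(q)}$ to $1$ and the other $M_{\alpha}^{(q)}$ to $0$. With $m$ the multiplication and $\eta$ the unit, this is an algebra and a co-algebra (a ''$q$-Hopf algebra'', not a Hopf algebra, since $\Delta$ is not multiplicative), and its antipode is the unique $R[q]$-linear map $S$ with $m\circ(S\otimes\operatorname{Id})\circ\Delta=\eta\circ\varepsilon=m\circ(\operatorname{Id}\otimes S)\circ\Delta$, which exists. *)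

(* Defs.v *)
From HB Require Import structures.
From mathcomp Require Import all_boot all_order all_algebra.
From mathcomp Require Export finmap monalg.

Set Implicit Arguments.
Unset Strict Implicit.
Unset Printing Implicit Defensive.

Import GRing.Theory.
Local Open Scope ring_scope.

(* Positive integers are kept as a subtype of nat, so that compositions are
   plain sequences (of arbitrary size, the empty one included). *)
Definition part : Type := {i : nat | (0 < i)%N}.
HB.instance Definition _ := Choice.on part.

Lemma part_add_subproof (a b : part) : (0 < val a + val b)%N.
Proof. by rewrite addn_gt0 (valP a). Qed.

Definition part_add (a b : part) : part :=
  exist (fun i => (0 < i)%N) (val a + val b)%N (part_add_subproof a b).

Definition composition : Type := seq part.
HB.instance Definition _ := Choice.on composition.

(* The n such that al is a composition of n. *)
Definition weight (al : composition) : nat := sumn (map val al).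

(* The A-linear map out of the free module on I with given values on the
   basis elements << i >>. *)
HB.lock Definition lin_ext (A : comNzRingType) (I : choiceType) (V : lmodType A)
    (f : I -> V) (u : {malg A[I]}) : V :=
  \sum_(i <- msupp u) u@_i *: f i.

Section LinearExtension.
Variables (A : comNzRingType) (I : choiceType) (V : lmodType A).

Lemma lin_extEw (f : I -> V) (u : {malg A[I]}) (d : {fset I}) :
  (msupp u `<=` d)%fset -> lin_ext f u = \sum_(i <- d) u@_i *: f i.
Proof.
move=> sub; rewrite lin_ext.unlock; apply: big_fset_incl => // i _ /mcoeff_outdom ->.
by rewrite scale0r.
Qed.

Lemma lin_ext_is_linear (f : I -> V) : linear (lin_ext f).
Proof.
move=> c u v; pose d := (msupp u `|` msupp v `|` msupp (c *: u + v))%fset.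
rewrite !(@lin_extEw _ _ d) ?fsubsetUr //.
- rewrite scaler_sumr -big_split; apply: eq_bigr => i _ /=.
  by rewrite mcoeffD mcoeffZ scalerDl scalerA.
- by rewrite /d -fsetUA fsetUCA fsubsetUl.
- by rewrite /d -fsetUA fsubsetUl.
Qed.

HB.instance Definition _ (f : I -> V) :=
  GRing.isLinear.Build A {malg A[I]} V *:%R (lin_ext f) (lin_ext_is_linear f).

Lemma lin_extU (f : I -> V) (i : I) : lin_ext f << i >> = f i.
Proof.
rewrite (@lin_extEw _ _ [fset i]%fset) ?msuppU_le //.
by rewrite big_seq_fset1 mcoeffUU scale1r.
Qed.

End LinearExtension.

(* The base ring is R[q] = {poly R}, with q = 'X. The carrier of QSym^(q) is
   the free module on compositions; << al >> is M_al. *)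
Notation QSym R := {malg {poly R}[composition]}.

(* Tensor products over R[q] of free modules: the free module on pairs of
   basis elements; QSym (x) QSym is the free module with basis
   M_al (x) M_be = << (al, be) >>. *)
Notation QSym2 R := {malg {poly R}[(composition * composition)%type]}.

Section QHopf.
Variable R : comNzRingType.
Implicit Types (al be : composition) (u v : QSym R).

Definition M al : QSym R := << al >>.

Definition tensor u v : QSym2 R :=
  \sum_(al <- msupp u) \sum_(be <- msupp v) << u@_al * v@_be *g (al, be) >>.

(* f (x) g *)
Definition tensor_map (f g : QSym R -> QSym R) : QSym2 R -> QSym2 R :=
  lin_ext (fun p => tensor (f (M p.1)) (g (M p.2))).

(* l_a, prepending the part a *)
Definition prepend (a : part) : QSym R -> QSym R :=
  lin_ext (fun al => M (a :: al)).

(* M_al * M_be *)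
Fixpoint mulM al be {struct al} : QSym R :=
  match al with
  | [::] => M be
  | a :: al' =>
    (fix mulM_al be : QSym R :=
      match be with
      | [::] => M al
      | b :: be' =>
          prepend a (mulM al' be)
          + 'X^(val b * (val a + weight al')) *: prepend b (mulM_al be')
          + 'X^(val b * weight al') *: prepend (part_add a b) (mulM al' be')
      end) be
  end.

Definition qmul : QSym2 R -> QSym R := lin_ext (fun p => mulM p.1 p.2).

Definition qunit (c : {poly R}) : QSym R := c *: M [::].

Definition qcomul : QSym R -> QSym2 R :=
  lin_ext (fun al => \sum_(k < (size al).+1) << (take k al, drop k al) >>).

Definition qcounit : QSym R -> {poly R} :=
  @lin_ext _ _ {poly R}^o (fun al => (al == [::])%:R).

Definition is_antipode (S : {linear QSym R -> QSym R}) : Prop :=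
  qmul \o tensor_map S id \o qcomul =1 qunit \o qcounit /\
  qmul \o tensor_map id S \o qcomul =1 qunit \o qcounit.

End QHopf.

(* The lemmas below check that mulM is the product of the power series
   M_al = \sum_(i_1 < ... < i_l) x_(i_1)^al_1 ... x_(i_l)^al_l
   in variables with x_j x_i = q x_i x_j for i < j.
   A sequence c of nats encodes the monomial x_1^c_1 ... x_n^c_n, and a power
   series is given by its coefficients. Reordering gives
   x^a x^b = q^(\sum_(i < j) a_j * b_i) x^(a + b). *)

Fixpoint swaps (a b : seq nat) : nat :=
  match a, b with
  | _ :: a', y :: b' => y * sumn a' + swaps a' b'
  | _, _ => 0
  end%N.

(* all the pairs (a, b) with a + b = c *)
Fixpoint splits (c : seq nat) : seq (seq nat * seq nat) :=
  if c is x :: c' then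
    [seq (y :: p.1, (x - y)%N :: p.2) | y <- iota 0 x.+1, p <- splits c']
  else [:: ([::], [::])].

Section PowerSeries.
Variable R : comNzRingType.

Definition psmul (f g : seq nat -> {poly R}) (c : seq nat) : {poly R} :=
  \sum_(p <- splits c) 'X^(swaps p.1 p.2) * (f p.1 * g p.2).

(* the coefficients of the power series M_al *)
Definition psM (al : composition) (c : seq nat) : {poly R} :=
  ([seq i <- c | (0 < i)%N] == map val al)%:R.

Definition series (u : QSym R) (c : seq nat) : {poly R} :=
  @lin_ext _ _ {poly R}^o (fun al => psM al c) u.

Lemma seriesE (u : QSym R) (al : composition) : series u (map val al) = u@_al.
Proof.
have fE (s : composition) : [seq i <- map val s | (0 < i)%N] = map val s.
  by apply/all_filterP/allP => _ /mapP[a _ ->]; exact: valP.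
rewrite /series lin_ext.unlock /psM fE.
under eq_bigr => i _ do rewrite (inj_eq (inj_map val_inj)).
case: (boolP (al \in msupp u)) => [al_u|al_u].
  rewrite (big_fsetD1 al) //= eqxx big1_fset; first by rewrite addr0 [LHS]mulr1.
  by move=> i; rewrite in_fsetD1 eq_sym => /andP[/negbTE-> _] _; rewrite [LHS]mulr0.
rewrite (mcoeff_outdom al_u) big1_fset // => i i_u _.
by case: eqP al_u i_u => [-> /negbTE->|_ _ _] //; rewrite [LHS]mulr0.
Qed.

Lemma psM_cons0 al c : psM al (0%N :: c) = psM al c.
Proof. by []. Qed.

Lemma psM_nilS y c : psM [::] (y.+1 :: c) = 0.
Proof. by []. Qed.

Lemma psM_consS a al y c :
  psM (a :: al) (y.+1 :: c) = (y.+1 == val a)%:R * psM al c.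
Proof. by rewrite /psM /= eqseq_cons -mulnb natrM. Qed.

Lemma seriesM al c : series (M R al) c = psM al c.
Proof. exact: (@lin_extU _ _ {poly R}^o). Qed.

Lemma seriesZ k u c : series (k *: u) c = k * series u c.
Proof. by rewrite /series linearZ. Qed.

Lemma series_comb k l u v w c : series (u + k *: v + l *: w) c =
  series u c + k * series v c + l * series w c.
Proof. by rewrite -!seriesZ /series !linearD. Qed.

Lemma series_prependE a u c : series (prepend a u) c =
  \sum_(al <- msupp u) u@_al * psM (a :: al) c.
Proof.
rewrite {1}/prepend lin_ext.unlock /series raddf_sum; apply: eq_bigr => al _.
by rewrite [LHS]seriesZ -seriesM.
Qed.

Lemma series_prepend_nil a u : series (prepend a u) [::] = 0.
Proof. by rewrite series_prependE big1 // => al _; rewrite mulr0. Qed.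

Lemma series_prepend0 a u c :
  series (prepend a u) (0%N :: c) = series (prepend a u) c.
Proof. by rewrite !series_prependE. Qed.

Lemma series_prependS a u x c :
  series (prepend a u) (x.+1 :: c) = (x.+1 == val a)%:R * series u c.
Proof.
rewrite series_prependE /series lin_ext.unlock mulr_sumr; apply: eq_bigr => al _.
by rewrite psM_consS mulrCA.
Qed.

Lemma series_mulM_nil a b al be :
  series (mulM R (a :: al) (b :: be)) [::] = 0.
Proof.
have comb0 d e f k l u v w :
    series (prepend d u + k *: prepend e v + l *: prepend f w) [::] = 0.
  by rewrite series_comb !series_prepend_nil !mulr0 !addr0.
exact: comb0.
Qed.

Lemma series_mulM_S a b al be x c :
  series (mulM R (a :: al) (b :: be)) (x.+1 :: c) =
  (x.+1 == val a)%:R * series (mulM R al (b :: be)) c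
  + 'X^(val b * (val a + weight al))
    * ((x.+1 == val b)%:R * series (mulM R (a :: al) be) c)
  + 'X^(val b * weight al)
    * ((x.+1 == val a + val b)%N%:R * series (mulM R al be) c).
Proof.
have combS d e f k l u v w :
    series (prepend d u + k *: prepend e v + l *: prepend f w) (x.+1 :: c) =
    (x.+1 == val d)%:R * series u c + k * ((x.+1 == val e)%:R * series v c)
    + l * ((x.+1 == val f)%:R * series w c).
  by rewrite series_comb !series_prependS.
exact: combS.
Qed.

Lemma psM_weight al c : psM al c != 0 -> sumn c = weight al.
Proof.
rewrite /psM; have [e _|_ /eqP //] := eqVneq [seq i <- c | (0 < i)%N] (map val al).
rewrite /weight -e; elim: c {e} => //= -[|x] c -> //.
Qed.

Lemma psmul_shift al be j c :
  \sum_(p <- splits c)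
     'X^(j * sumn p.1 + swaps p.1 p.2) * (psM al p.1 * psM be p.2)
  = 'X^(j * weight al) * psmul (psM al) (psM be) c.
Proof.
rewrite mulr_sumr; apply: eq_bigr => p _.
have [->|/psM_weight ->] := eqVneq (psM al p.1) 0.
  by rewrite mul0r !mulr0.
by rewrite exprD -mulrA.
Qed.

Lemma psmul_cons f g x c : psmul f g (x :: c) =
  \sum_(y <- iota 0 x.+1) \sum_(p <- splits c)
    'X^((x - y) * sumn p.1 + swaps p.1 p.2)
    * (f (y :: p.1) * g ((x - y)%N :: p.2)).
Proof. exact: big_allpairs_dep. Qed.

Let mulr_pull (e k f g : {poly R}) : k * (f * (e * g)) = e * (k * (f * g)).
Proof. by rewrite (mulrCA f) (mulrCA k). Qed.

Let mull_pull (e k f g : {poly R}) : k * ((e * f) * g) = e * (k * (f * g)).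
Proof. by rewrite -mulrA mulrCA. Qed.

Lemma psmul_nill be c : psmul (psM [::]) (psM be) c = psM be c.
Proof.
elim: c be => [|x c IH] be; first by rewrite /psmul big_seq1 /= !mul1r.
rewrite psmul_cons big_cons subn0 [X in _ + X]big1_seq ?addr0; last first.
  move=> y; rewrite mem_iota => /andP[_ /andP[y_gt0 _]].
  rewrite big1 // => p _; case: y y_gt0 => // y _.
  by rewrite psM_nilS mul0r mulr0.
case: x => [|x].
  under eq_bigr => p _ do rewrite !psM_cons0.
  by rewrite (psmul_shift _ _ 0) mul0n mul1r IH.
case: be => [|b be].
  by rewrite big1 // => p _; rewrite psM_nilS !mulr0.
under eq_bigr => p _ do rewrite psM_cons0 psM_consS mulr_pull.
rewrite -mulr_sumr psmul_shift muln0 mul1r IH.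
by rewrite psM_consS.
Qed.

Lemma psmul_nilr al c : psmul (psM al) (psM [::]) c = psM al c.
Proof.
elim: c al => [|x c IH] al; first by rewrite /psmul big_seq1 /= mul1r mulr1.
rewrite psmul_cons -addn1 iotaD big_cat big_seq1 /= subnn.
rewrite [X in X + _]big1_seq ?add0r.
  case: x => [|x].
    under eq_bigr => p _ do rewrite !psM_cons0.
    by rewrite (psmul_shift _ _ 0) mul0n mul1r IH.
  case: al => [|a al].
    by rewrite big1 // => p _; rewrite psM_nilS mul0r mulr0.
  under eq_bigr => p _ do
    rewrite psM_cons0 psM_consS mull_pull.
  by rewrite -mulr_sumr (psmul_shift _ _ 0) mul0n mul1r IH psM_consS.
move=> y; rewrite mem_iota add0n => /andP[_ /andP[_ lt_yx]].
rewrite big1 // => p _.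
by rewrite -(subnSK lt_yx) psM_nilS !mulr0.
Qed.

Lemma psmul_M al be c : psmul (psM al) (psM be) c = series (mulM R al be) c.
Proof.
elim: c al be => [|x c IH] [|a al] [|b be].
1-3, 5-7: by rewrite ?psmul_nill ?psmul_nilr -seriesM.
  by rewrite series_mulM_nil /psmul big_seq1 [psM _ _]/psM mul0r mulr0.
rewrite psmul_cons; case: x => [|x].
  rewrite big_seq1 subn0.
  under eq_bigr => p _ do rewrite !psM_cons0.
  by rewrite (psmul_shift _ _ 0) mul0n mul1r IH.
rewrite series_mulM_S -!IH; have -> : iota 0 x.+2 = 0%N :: rcons (iota 1 x) x.+1.
  by rewrite -cats1 -cat1s -[x.+2]add1n iotaD -[x.+1 in LHS]addn1 iotaD.
rewrite big_cons big_rcons /= subn0 subnn.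
under eq_bigr => p _ do rewrite psM_cons0 psM_consS mulr_pull.
rewrite -mulr_sumr psmul_shift.
under [X in _ + (_ + X)]eq_bigr => p _ do
  rewrite psM_cons0 psM_consS mull_pull.
rewrite -mulr_sumr (psmul_shift _ _ 0) mul0n mul1r.
have -> : \sum_(y <- iota 1 x) \sum_(p <- splits c)
      'X^((x.+1 - y) * sumn p.1 + swaps p.1 p.2)
      * (psM (a :: al) (y :: p.1) * psM (b :: be) ((x.+1 - y)%N :: p.2))
    = (x.+1 == val a + val b)%N%:R
      * ('X^(val b * weight al) * psmul (psM al) (psM be) c).
  transitivity (\sum_(y <- iota 1 x)
      (y == val a)%:R * ((x.+1 - y)%N == val b)%:R
      * ('X^(val b * weight al) * psmul (psM al) (psM be) c)).
    apply: eq_big_seq => y; rewrite mem_iota add1n ltnS => /andP[y_gt0 le_yx].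
    case: y y_gt0 le_yx => // y _ lt_yx.
    rewrite subSS -(subnSK lt_yx) -psmul_shift mulr_sumr.
    apply: eq_bigr => p _; rewrite !psM_consS.
    have [<-|] := eqVneq (x - y.+1).+1 (val b).
      by rewrite mul1r mulr1 -mulrA mulrCA.
    by rewrite mul0r !mulr0 mul0r.
  rewrite -mulr_suml; congr (_ * _).
  have [eab|neab] := eqVneq.
    have a_in : val a \in iota 1 x.
      by rewrite mem_iota (valP a) add1n eab -addn1 leq_add2l (valP b).
    rewrite (bigD1_seq (val a)) ?iota_uniq //= eqxx eab addKn eqxx mulr1.
    by rewrite big1 ?addr0 // => y /negbTE->; rewrite mul0r.
  rewrite big1_seq // => y; rewrite mem_iota add1n ltnS => /andP[_ /andP[_ le_yx]].
  have [ey|] := eqVneq y (val a); last by rewrite mul0r.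
  have [eb|] := eqVneq (x.+1 - y)%N (val b); last by rewrite mulr0.
  by move: neab; rewrite -ey -eb subnKC ?eqxx // leqW.
rewrite addrA addrC addrA.
congr (_ + _); last exact: mulrCA.
congr (_ + _).
by have [->|] := eqVneq x.+1 (val b); rewrite ?mul1r // !mul0r mulr0.
Qed.

End PowerSeries.

(* Main.v *)
(* The antipode equation in length at most two gives S M_(a) = - M_(a) and
   S M_(a,b) = q^(ab) M_(b,a) + M_(a+b). Hence S^2 is upper triangular on the
   span of M_(1,1) and M_(2), with the entry q^2 at M_(1,1), and q^(2k) <> 1. *)
Require Import Defs.
From mathcomp Require Import all_boot all_order all_algebra.

Import GRing.Theory.
Local Open Scope ring_scope.

Lemma lin_extE (A : comNzRingType) (I : choiceType) (V : lmodType A)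
    (f : I -> V) (u : {malg A[I]}) :
  lin_ext f u = \sum_(i <- msupp u) u@_i *: f i.
Proof. by rewrite lin_ext.unlock. Qed.

Lemma malgUZ (A : comNzRingType) (I : choiceType) (c : A) (i : I) :
  << c *g i >> = c *: << i >> :> {malg A[I]}.
Proof. by apply/malgP => j; rewrite mcoeffZ !mcoeffU mulrnAr mulr1. Qed.

Section AntipodeLowLength.
Variable R : comNzRingType.
Implicit Types (u : QSym R) (al be : composition) (a b : part).

Lemma mulM_nilr al : mulM R al [::] = M R al.
Proof. by case: al. Qed.

Lemma prependM a al : prepend a (M R al) = M R (a :: al).
Proof. exact: lin_extU. Qed.

Lemma mulM_parts a b :
  mulM R [:: a] [:: b] =
  M R [:: a; b] + 'X^(val b * val a) *: M R [:: b; a] + M R [:: part_add a b].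
Proof. by rewrite /= !prependM /weight /= addn0 muln0 expr0 scale1r. Qed.

(** The support of [M R be] is the single composition [be], so the inner sum in [tensor] has one
    term. This turns each summand of the antipode equation into right multiplication by a basis
    element. *)
Lemma qmul_tensorM u be :
  qmul (tensor u (M R be)) = lin_ext (fun al => mulM R al be) u.
Proof.
rewrite [RHS]lin_extE /qmul /tensor raddf_sum; apply: eq_bigr => al _ /=.
by rewrite /M msuppU oner_eq0 big_seq_fset1 mcoeffUU mulr1 malgUZ linearZ /= lin_extU.
Qed.

Variable S : {linear QSym R -> QSym R}.
Hypothesis hS : is_antipode S.

(** This is the left antipode equation evaluated at a basis element. Its last summand,
    [k = size al], is [S (M R al)] itself, so the equation determines [S] recursively on the
    length. *)
Lemma antipode_sumE al :
  \sum_(k < (size al).+1)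
     lin_ext (fun ga => mulM R ga (drop k al)) (S (M R (take k al)))
  = (al == [::])%:R *: M R [::].
Proof.
have [/(_ (M R al)) /= + _] := hS.
rewrite /qunit /qcounit (@lin_extU _ _ {poly R}^o) /qcomul lin_extU => <-.
rewrite /tensor_map /qmul !raddf_sum; apply: eq_bigr => k _ /=.
by rewrite lin_extU /= -qmul_tensorM.
Qed.

Lemma lin_ext_mulM_nil u : lin_ext (fun ga => mulM R ga [::]) u = u.
Proof.
rewrite lin_extE [RHS]monalgE; apply: eq_bigr => al _.
by rewrite mulM_nilr malgUZ.
Qed.

Lemma antipode_nil : S (M R [::]) = M R [::].
Proof.
have := antipode_sumE [::].
by rewrite big_ord_recl big_ord0 addr0 /= lin_ext_mulM_nil scale1r.
Qed.

Lemma antipode_part a : S (M R [:: a]) = - M R [:: a].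
Proof.
have := antipode_sumE [:: a].
rewrite !big_ord_recl big_ord0 addr0 /= antipode_nil lin_ext_mulM_nil lin_extU.
by rewrite scale0r addrC => /eqP; rewrite addr_eq0 => /eqP.
Qed.

Lemma antipode_pair a b :
  S (M R [:: a; b]) =
  'X^(val b * val a) *: M R [:: b; a] + M R [:: part_add a b].
Proof.
have := antipode_sumE [:: a; b].
rewrite !big_ord_recl big_ord0 addr0 /= antipode_nil antipode_part.
rewrite lin_ext_mulM_nil linearN /= !lin_extU mulM_parts scale0r addrA => /eqP.
(* The summand [k = 0] is [M R [:: a; b]]; it cancels the same term in the expansion of the product
   of [M R [:: a]] and [M R [:: b]]. *)
by rewrite addrC addr_eq0 => /eqP->; rewrite opprD opprK -[X in - _ + X]addrA addKr.
Qed.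

End AntipodeLowLength.

Theorem corollary3p31 (R : comNzRingType) (S : {linear QSym R -> QSym R})
    (hS : is_antipode S) (k : nat) (hk : (1 <= k)%N) :
  ~ (iter k (S \o S) =1 id).
Proof.
pose i1 : part := exist (fun i => (0 < i)%N) 1%N isT.
pose i2 := part_add i1 i1.
have S11 : S (M R [:: i1; i1]) = 'X *: M R [:: i1; i1] + M R [:: i2].
  by rewrite (antipode_pair _ _ hS).
have S2 : S (M R [:: i2]) = - M R [:: i2] by exact: antipode_part.
have [c iterE] : exists c : {poly R}, iter k (S \o S) (M R [:: i1; i1]) =
    'X^(2 * k) *: M R [:: i1; i1] + c *: M R [:: i2].
  elim: k {hk} => [|k [c IH]].
    by exists 0; rewrite muln0 expr0 scale1r scale0r addr0.
  (* [S \o S] fixes [M R [:: i2]] and sends [M R [:: i1; i1]] to ['X^2 *: M R [:: i1; i1] + ('X - 1)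
     *: M R [:: i2]]. *)
  exists ('X^(2 * k) * ('X - 1) + c).
  rewrite iterS IH /= !(linearD, linearZ) /= S11 S2.
  rewrite !(linearD, linearZ, linearN) /= S11 S2 opprK.
  rewrite mulnS addnC exprD expr2 scalerDl -!scalerA scalerBl scale1r.
  by rewrite scalerA mulrC -scalerA addrA -!scalerDr addrA -scalerDr.
move=> /(_ (M R [:: i1; i1])); rewrite iterE => /(congr1 (mcoeff [:: i1; i1])).
rewrite mcoeffD !mcoeffZ !mcoeffU eqxx /= mulr1 mulr0 addr0.
(* What remains is ['X^(2 * k) = 1]. As [R] is non-zero, the sizes are [2 * k + 1] and [1], which
   differ for positive [k]. *)
move=> /(congr1 (fun p : {poly R} => size p)).
by rewrite size_polyXn size_poly1; case: k hk {iterE}.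
Qed.
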